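(* Let $G$ be a finite simple undirected graph of diameter $d$ and let $D\subseteq\{0,1,\ldots,d\}$ with $D\ne\{0\}$. If $G$ contains two distinct vertices $x$ and $y$ such that $|N_D(x)\cap N_D(y)|=|N_D(x)|-1=|N_D(y)|-1$, then $G$ is not $D$-distance magic.
   Context: Let $G=(V,E)$ be a finite simple undirected graph with $v=|V|$ vertices, and let $d(x,y)$ be the graph distance (vertices in different connected components are at infinite distance; for a non-connected graph, $d$ denotes the largest diameter of a connected component). For a set $D$ of nonnegative integers and $x\in V$, put $N_D(x)=\{y\in V : d(x,y)\in D\}$. A $D$-distance magic labeling of $G$ is a bijection $f:V\to\{1,2,\ldots,v\}$ for which there is a constant $\mathsf{k}$ such that $\sum_{y\in N_D(x)} f(y)=\mathsf{k}$ for every $x\in V$. $G$ is called $D$-distance magic if it admits a $D$-distance magic labeling. *)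

(* Defs.v *)
From mathcomp Require Import all_boot.

Set Implicit Arguments.
Unset Strict Implicit.
Unset Printing Implicit Defensive.

Record sgraph := SGraph {
  vertex :> finType;
  adj : rel vertex;
  adj_sym : symmetric adj;
  adj_irrefl : irreflexive adj
}.

Section Distance.
Variable G : sgraph.
Implicit Types (x y : G) (n : nat).

Definition walk n x y : bool :=
  [exists p : n.-tuple G, path (@adj G) x p && (last x p == y)].

Lemma connect_walk x y : connect (@adj G) x y -> exists n, walk n x y.
Proof.
move=> /connectP[p xp ->]; exists (size p).
by apply/existsP; exists (in_tuple p); rewrite xp eqxx.
Qed.

(* None stands for infinite distance. *)
Definition gdist x y : option nat :=
  if @idP (connect (@adj G) x y) is ReflectT xy
  then Some (ex_minn (connect_walk xy)) else None.

Lemma gdistP x y n :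
  gdist x y = Some n <-> walk n x y /\ (forall m, walk m x y -> n <= m).
Proof.
rewrite /gdist; case: {-}_ / idP => [xy|nxy].
  case: ex_minnP => m wm min_m; split=> [[<-] //|[wn min_n]].
  by congr Some; apply/eqP; rewrite eqn_leq min_m // min_n.
split=> // -[/existsP[p /andP[xp /eqP py]] _]; case: nxy.
by apply/connectP; exists p.
Qed.

(* Pairs at infinite distance contribute 0, so this is the largest diameter
   of a connected component. *)
Definition diameter : nat :=
  \max_(x : G) \max_(y : G) odflt 0 (gdist x y).

Definition D_neighborhood (D : {pred nat}) x : {set G} :=
  [set y | if gdist x y is Some n then n \in D else false].

Definition D_distance_magic_labeling (D : {pred nat}) (f : G -> nat) : Prop :=
  [/\ forall x, 1 <= f x <= #|G|,
      injective f,
      forall i, 1 <= i <= #|G| -> exists x, f x = i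
    & exists k, forall x, \sum_(y in D_neighborhood D x) f y = k].

Definition D_distance_magic (D : {pred nat}) : Prop :=
  exists f : G -> nat, D_distance_magic_labeling D f.

End Distance.

(* Main.v *)
Require Import Defs.
From mathcomp Require Import all_boot all_order all_algebra.

(** The hypothesis on cardinals says that the two neighborhoods differ by
    exchanging a single vertex: removing their intersection leaves [set a] on
    one side and [set b] on the other, with a and b distinct. Cancelling the
    labels of the common vertices, equality of the two neighborhood sums would
    force a and b to have the same label, against injectivity. *)

Lemma sum_neq_exchange (T : finType) (f : T -> nat) (A B : {set T}) :
  injective f -> #|A :\: B| = 1 -> #|B :\: A| = 1 ->
  \sum_(z in A) f z <> \sum_(z in B) f z.
Proof.
move=> f_inj /eqP/cards1P[a AB] /eqP/cards1P[b BA].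
rewrite (big_setID B) [in RHS](big_setID A) /= AB BA !big_set1 (setIC B A).
move=> /eqP; rewrite eqn_add2l => /eqP/f_inj ab.
have : a \in A :\: B by rewrite AB set11.
have : a \in B :\: A by rewrite BA ab set11.
by rewrite !inE => /andP[/negPf-> _]; rewrite andbF.
Qed.

Theorem lemma4 (G : sgraph) (D : {pred nat})
  (D_sub : forall n : nat, n \in D -> n <= diameter G)
  (D_neq0 : ~ (D =i pred1 0))
  (x y : G) (x_neq_y : x <> y)
  (card_x : (#|D_neighborhood D x :&: D_neighborhood D y|%:Z =
             #|D_neighborhood D x|%:Z - 1)%R)
  (card_y : (#|D_neighborhood D x|%:Z - 1 =
             #|D_neighborhood D y|%:Z - 1)%R) :
  ~ D_distance_magic G D.
Proof.
case=> f [_ f_inj _ [k sum_f]].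
set A := D_neighborhood D x in card_x card_y.
set B := D_neighborhood D y in card_x card_y.
have cardA : #|A| = #|A :&: B| + 1.
  by apply/eqP; rewrite -eqz_nat PoszD card_x GRing.subrK.
have cardB : #|B| = #|A :&: B| + 1.
  by apply/eqP; rewrite -eqz_nat PoszD card_x card_y GRing.subrK.
apply: (@sum_neq_exchange G f A B) => //; last by rewrite !sum_f.
- by rewrite cardsD cardA addKn.
- by rewrite cardsD setIC cardB addKn.
Qed.
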